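(* Let $d\ge1$ and let $F:\mathbb{N}\to\mathbb{R}^+$ be any function with $\lim_{L\to\infty}F_L/L^d=0$. Then there exists a Lebesgue measurable set $\mathbb{M}\subset\mathbb{T}^d$ such that the entropy $S_L$ of the pure translation-invariant quasi-free state $\omega_{\mathbb{M}}$ restricted to $\{1,\dots,L\}^d$ satisfies $S_L\ge F_L$ for all sufficiently large $L$.
   Context: $\mathbb{T}^d=(\mathbb{R}/2\pi\mathbb{Z})^d$ is the $d$-dimensional torus, parametrized by $[-\pi,\pi)^d$, with Lebesgue measure $|\cdot|$. For a measurable set $\mathbb{M}\subset\mathbb{T}^d$ with characteristic function $\chi_{\mathbb{M}}$, define the infinite matrix $Q$ indexed by $\mathbf{k},\mathbf{l}\in\mathbb{Z}^d$ by $$Q_{\mathbf{k},\mathbf{l}}=\frac{1}{(2\pi)^d}\int_{[-\pi,\pi)^d}\chi_{\mathbb{M}}(\mathbf{a})\,e^{-i(\mathbf{l}-\mathbf{k})\cdot\mathbf{a}}\,d\mathbf{a}.$$ This $Q$ is the symbol of the pure, translation- and gauge-invariant quasi-free state $\omega_{\mathbb{M}}$ on the CAR algebra over $\ell^2(\mathbb{Z}^d)$. For an integer $L\ge1$ let $Q_L$ be the $L^d\times L^d$ submatrix $(Q_{\mathbf{k},\mathbf{l}})_{\mathbf{k},\mathbf{l}\in\{1,\dots,L\}^d}$, and $$S_L=-\operatorname{Tr}\big(Q_L\ln Q_L+(\mathbb{1}-Q_L)\ln(\mathbb{1}-Q_L)\big)$$ (with $0\ln0=0$), the von Neumann entropy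 of the restriction of $\omega_{\mathbb{M}}$ to $\{1,\dots,L\}^d$. *)

(* Defs.v *)
From HB Require Import structures.
From mathcomp Require Import all_boot all_order all_algebra.
From mathcomp Require Import spectral.
From mathcomp Require Import complex.
From mathcomp Require Import all_classical all_reals all_analysis.

Set Implicit Arguments.
Unset Strict Implicit.
Unset Printing Implicit Defensive.

Import Order.TTheory GRing.Theory Num.Theory.
Local Open Scope ring_scope.
Local Open Scope classical_set_scope.

(* Points of the torus T^d are parametrized by [-pi,pi)^d; we represent a
   point a of R^d as a d-tuple of reals (with the canonical product
   sigma-algebra of the Borel sigma-algebra of R). *)
Definition torus_cube (R : realType) (d : nat) : set (d.-tuple R) :=
  [set a | forall i : 'I_d, (- pi <= tnth a i) /\ (tnth a i < pi)].

(* Integral of f over [-pi,pi)^d w.r.t. d-dimensional Lebesgue measure,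
   computed as an iterated Lebesgue integral (Fubini). *)
Fixpoint cube_integral (R : realType) (n : nat) : (n.-tuple R -> R) -> R :=
  match n return (n.-tuple R -> R) -> R with
  | 0 => fun f => f [tuple]
  | n'.+1 => fun f =>
      Rintegral (@lebesgue_measure R) `[(- pi)%R, pi[%classic
        (fun x : R => cube_integral (fun t : n'.-tuple R => f (cons_tuple x t)))
  end.

Definition chi (T : Type) (R : realType) (M : set T) (x : T) : R :=
  if `[< M x >] then 1 else 0.

Definition dotZR (R : realType) (d : nat) (m : 'I_d -> int) (a : d.-tuple R) : R :=
  \sum_(j < d) (m j)%:~R * tnth a j.

(* Q_{k,l} = (2 pi)^{-d} \int_M e^{-i (l-k).a} da
          = (2 pi)^{-d} ( \int_M cos((l-k).a) da  - i \int_M sin((l-k).a) da ) *)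
Definition Qsymbol (R : realType) (d : nat) (M : set (d.-tuple R))
    (k l : 'I_d -> int) : R[i] :=
  let c := ((2 * pi) ^+ d)^-1 in
  let m := fun j => l j - k j in
  Complex
    (c * cube_integral (fun a => chi R M a * cos (dotZR m a)))
    (- (c * cube_integral (fun a => chi R M a * sin (dotZR m a)))).

(* Index set {1,...,L}^d; the point f : 'I_d -> 'I_L has coordinates
   k_j = f j + 1. *)
Definition boxidx (d L : nat) := {ffun 'I_d -> 'I_L}.

Definition boxpt (d L : nat) (f : boxidx d L) : 'I_d -> int :=
  fun j => ((f j : nat).+1)%:Z.

Definition QL (R : realType) (d : nat) (M : set (d.-tuple R)) (L : nat) :
    'M[R[i]]_(#|{: boxidx d L}|) :=
  \matrix_(p, q) Qsymbol M (boxpt (enum_val p)) (boxpt (enum_val q)).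

Definition xlnx (R : realType) (x : R) : R := if x == 0 then 0 else x * ln x.

Definition hbin (R : realType) (x : R) : R := - (xlnx x + xlnx (1 - x)).

(* von Neumann entropy -Tr(Q ln Q + (1-Q) ln(1-Q)) of a hermitian matrix Q
   with 0 <= Q <= 1, computed by the functional calculus:
   Q = P^-1 diag(lambda) P (spectral theorem, P unitary), so that
   Tr h(Q) = sum_i h(lambda_i); the eigenvalues lambda_i are real. *)
Definition vN_entropy (R : realType) (n : nat) (Q : 'M[R[i]]_n) : R :=
  \sum_(i < n) hbin (complex.Re (spectral_diag Q 0 i)).

Definition S_L (R : realType) (d : nat) (M : set (d.-tuple R)) (L : nat) : R :=
  vN_entropy (QL M L).

(* Main.v *)
Require Import Defs.
From HB Require Import structures.
From mathcomp Require Import all_boot all_order all_algebra.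
From mathcomp Require Import spectral complex.
From mathcomp Require Import ring lra.
From mathcomp Require Import all_classical all_reals all_analysis.

(* From h(x) >= 2 x (1 - x) we get S_L >= 2 Tr(Q_L - Q_L^2).  Take for M the
   points of the cube with first coordinate in a set N of the circle T.  Then
   Tr(Q_L - Q_L^2) = L^(d-1) / (2 pi)^2 * E_L(N, T \ N), where E_L(X, Y) is the
   integral over X * Y of |\sum_(k < L) e^(i k (a - b))|^2, which is monotone
   in X and Y.
   Fix disjoint intervals I_n of length d_n.  If X_n is a union of intervals
   occupying half of I_n on a scale much finer than 1 / K, then X_n and
   Y_n = I_n \ X_n have nearly equal Fourier coefficients of order below K, and
   E_L(X_n, Y_n) is close to E_L(I_n, I_n) / 4 >= L d_n^2 / 4 for L <= K.
   With N = \bigcup_n X_n, this gives Tr(Q_L - Q_L^2) >= c L^d d_n^2 for all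
   L <= K_(n+1), where K_n is such that F_L / L^d <= c d_n^2 for L >= K_n. *)

Import Order.TTheory GRing.Theory Num.Theory numFieldNormedType.Exports.
Local Open Scope ring_scope.
Local Open Scope classical_set_scope.

(** * Integrals over measurable subsets of the circle, and finely halved intervals *)

Section Circle.
Context {R : realType}.
Notation mu := (@lebesgue_measure R).
Notation circle := (`[(- pi)%R, pi[%classic : set R).
Implicit Types (X Y : set R) (f g : R -> R).

(** Such a set lies in a compact interval, so continuous functions are integrable on it and the
    integration rules below ask only for continuity of the integrand. *)
Definition arcset X := measurable X /\ X `<=` circle.

Lemma integrable_arcset X f : arcset X -> continuous f ->
  mu.-integrable X (EFin \o f).
Proof.
move=> [mX sX] cf; apply: (@integrableS _ _ _ mu `[(- pi)%R, pi]) => //.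
  by apply: (subset_trans sX) => x /=; rewrite !in_itv/= => /andP[-> /ltW].
apply: continuous_compact_integrable; first exact: segment_compact.
exact: continuous_subspaceT.
Qed.

Lemma le_Rintegral_arcset X f g : arcset X -> continuous f -> continuous g ->
  (forall x, X x -> f x <= g x) ->
  \int[mu]_(x in X) f x <= \int[mu]_(x in X) g x.
Proof.
move=> aX cf cg; have [mX _] := aX.
exact: (@le_Rintegral _ _ _ mu X f g mX (integrable_arcset X f aX cf)
  (integrable_arcset X g aX cg)).
Qed.

Lemma RintegralD_arcset X f g : arcset X -> continuous f -> continuous g ->
  \int[mu]_(x in X) (f x + g x) =
  \int[mu]_(x in X) f x + \int[mu]_(x in X) g x.
Proof.
move=> aX cf cg; have [mX _] := aX.
by apply: RintegralD => //; exact: integrable_arcset.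
Qed.

Lemma RintegralZl_arcset X f (r : R) : arcset X -> continuous f ->
  \int[mu]_(x in X) (r * f x) = r * \int[mu]_(x in X) f x.
Proof.
move=> aX cf; have [mX _] := aX.
by apply: RintegralZl => //; exact: integrable_arcset.
Qed.

Lemma Rintegral_approx X f (c e : R) : arcset X -> continuous f ->
  (forall x, X x -> `|f x - c| <= e) ->
  `|\int[mu]_(x in X) f x - c * fine (mu X)| <= e * fine (mu X).
Proof.
move=> aX cf fc; have [mX _] := aX.
rewrite ler_distl -mulrBl -mulrDl -!Rintegral_cst//; apply/andP; split.
- apply: le_Rintegral_arcset => //; first exact: cst_continuous.
  by move=> x /fc; rewrite ler_distl => /andP[].
- apply: le_Rintegral_arcset => //; first exact: cst_continuous.
  by move=> x /fc; rewrite ler_distl => /andP[].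
Qed.

Lemma arcsetU X Y : arcset X -> arcset Y -> arcset (X `|` Y).
Proof.
by move=> [mX sX] [mY sY]; split; [exact: measurableU|rewrite subUset].
Qed.

Lemma arcsetD X Y : arcset X -> measurable Y -> arcset (X `\` Y).
Proof.
by move=> [mX sX] mY; split; [exact: measurableD|move=> x [/sX]].
Qed.

Lemma arcset_circle : arcset circle.
Proof. by split. Qed.

Lemma Rintegral_arcsetU X Y f : arcset X -> arcset Y -> continuous f ->
  X `&` Y = set0 ->
  \int[mu]_(x in X `|` Y) f x = \int[mu]_(x in X) f x + \int[mu]_(x in Y) f x.
Proof.
move=> aX aY cf XY; rewrite Rintegral_setU//; [exact: aX.1|exact: aY.1| |].
  by apply: integrable_arcset => //; exact: arcsetU.
by apply/disj_setPS; rewrite XY.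
Qed.

Lemma itvco_bisect (a b : R) : a <= b -> let m := (a + b) / 2 in
  `[a, b[%classic = `[a, m[%classic `|` `[m, b[%classic /\
  `[a, m[%classic `&` `[m, b[%classic = set0.
Proof.
move=> ab m; split; apply/seteqP; split=> x //=; rewrite !in_itv/= /m.
- case: (ltP x ((a + b) / 2)) => h /andP[h1 h2]; [left|right];
    by apply/andP; lra.
- by case=> /andP[h1 h2]; apply/andP; lra.
- by case=> /andP[h1 h2] /andP[h3 h4]; lra.
Qed.

Lemma fine_measure_itvco (a b : R) : a <= b ->
  fine (mu `[a, b[%classic) = b - a.
Proof.
move=> ab; rewrite lebesgue_measure_itv/= lte_fin.
case: (ltP a b) => ba //=; lra.
Qed.

(** Cut [[a, b[] into [2 ^ j] equal pieces and let [X] collect their left halves. On a piece of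
    length l, [f] varies by at most C l, so the two halves differ by at most C l^2 in integral;
    summing over the pieces gives the bound. As [X] is chosen before [f], it serves all
    [C]-Lipschitz functions at once. *)
Lemma halving_set (C : R) (j : nat) (a b : R) :
  a <= b -> `[a, b[%classic `<=` circle ->
  exists X, [/\ measurable X, X `<=` `[a, b[%classic &
   forall f, continuous f -> (forall x y, `|f x - f y| <= C * `|x - y|) ->
    `|\int[mu]_(x in X) f x - \int[mu]_(x in `[a, b[%classic `\` X) f x|
       <= C * (b - a) ^+ 2 / 2 ^+ j].
Proof.
elim: j a b => [|j IHj] a b ab abc; have := itvco_bisect a b ab => /= -[].
all: set m := (a + b) / 2 => abE disj.
all: have am : a <= m by rewrite /m; lra.
all: have mb : m <= b by rewrite /m; lra.
all: have amc : `[a, m[%classic `<=` circle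
  by apply: subset_trans abc; rewrite abE; exact: subsetUl.
all: have mbc : `[m, b[%classic `<=` circle
  by apply: subset_trans abc; rewrite abE; exact: subsetUr.
- exists `[a, m[%classic; split=> //; first by rewrite abE; exact: subsetUl.
  move=> f cf lipf.
  have -> : `[a, b[%classic `\` `[a, m[%classic = `[m, b[%classic.
    rewrite abE setDUl setDv set0U setDidl// setIC//.
  have close x : a <= x -> x < b -> `|f x - f a| <= C * (b - a).
    move=> ax xb; have h1 := lipf x a; have h2 := lipf b a.
    (* The sign of [C] is read off the Lipschitz bound at [b] and [a], which are distinct because
       [a <= x < b]. *)
    have C0 : 0 <= C.
      have ba : 0 < `|b - a| by rewrite normr_gt0; apply/eqP; lra.
      by rewrite -(pmulr_lge0 _ ba) (le_trans _ h2).
    by apply: (le_trans h1); rewrite ler_wpM2l// ger0_norm; lra.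
  have am2 : m - a = (b - a) / 2 by rewrite /m; lra.
  have mb2 : b - m = (b - a) / 2 by rewrite /m; lra.
  have h1 : `|\int[mu]_(x in `[a, m[%classic) f x - f a * ((b - a) / 2)| <=
      C * (b - a) * ((b - a) / 2).
    rewrite -am2 -(fine_measure_itvco a m)//; apply: Rintegral_approx => //.
    by move=> x /=; rewrite in_itv/= => /andP[? ?]; apply: close; lra.
  have h2 : `|\int[mu]_(x in `[m, b[%classic) f x - f a * ((b - a) / 2)| <=
      C * (b - a) * ((b - a) / 2).
    rewrite -mb2 -(fine_measure_itvco m b)//; apply: Rintegral_approx => //.
    by move=> x /=; rewrite in_itv/= => /andP[? ?]; apply: close; lra.
  rewrite expr0 divr1; set i1 := Rintegral _ _ _ in h1 *.
  set i2 := Rintegral _ _ _ in h2 *.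
  have -> : i1 - i2 =
      (i1 - f a * ((b - a) / 2)) - (i2 - f a * ((b - a) / 2)) by ring.
  apply: (le_trans (ler_normB _ _)); apply: (le_trans (lerD h1 h2)).
  by rewrite le_eqVlt; apply/orP; left; apply/eqP; field.
- have [X1 [mX1 sX1 h1]] := IHj _ _ am amc.
  have [X2 [mX2 sX2 h2]] := IHj _ _ mb mbc.
  exists (X1 `|` X2); split; first exact: measurableU.
    by rewrite abE; exact: setUSS.
  move=> f cf lipf; have {}h1 := h1 f cf lipf; have {}h2 := h2 f cf lipf.
  have -> : `[a, b[%classic `\` (X1 `|` X2) =
      (`[a, m[%classic `\` X1) `|` (`[m, b[%classic `\` X2).
    rewrite abE; apply/seteqP; split=> x /=.
      by move=> [[?|?] /not_orP[? ?]]; [left|right].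
    (* A point of one half of the interval cannot lie in the set chosen inside the other half. *)
    have D : ~ (`[a, m[%classic x /\ `[m, b[%classic x).
      by move=> h; rewrite -[False]/(@set0 R x) -disj.
    case=> -[h nh]; split; [by left| |by right|];
      case=> // h'; apply: D; split=> //.
      exact: sX2.
    exact: sX1.
  rewrite !Rintegral_arcsetU//.
  + have -> : C * (b - a) ^+ 2 / 2 ^+ j.+1 =
        C * (m - a) ^+ 2 / 2 ^+ j + C * (b - m) ^+ 2 / 2 ^+ j.
      have q0 : (2 : R) ^+ j != 0 by rewrite expf_neq0.
      by rewrite /m [2 ^+ j.+1]exprS; move: (2 ^+ j) q0 => q q0; field.
    apply: (le_trans _ (lerD h1 h2)); rewrite opprD addrACA; exact: ler_normD.
  + by apply: arcsetD.
  + by apply: arcsetD.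
  + by rewrite -subset0 => x [[h _] [h' _]]; rewrite -disj.
  + by split=> // x /sX1/amc.
  + by split=> // x /sX2/mbc.
  + by rewrite -subset0 => x [/sX1 h /sX2 h']; rewrite -disj.
Qed.

End Circle.

(** * Real Fourier coefficients of subsets of the circle *)

Lemma sin_intmul_pi {R : realType} (k : int) : sin (k%:~R * pi : R) = 0.
Proof.
have nat_case (n : nat) : sin (n%:R * pi : R) = 0.
  elim: n => [|n IHn]; first by rewrite mul0r sin0.
  by rewrite -natr1 mulrDl mul1r sinDpi IHn oppr0.
by case: k => n; rewrite ?NegzE -?pmulrn ?mulrNz ?mulNr ?sinN ?nat_case ?oppr0.
Qed.

Section FourierCoefficients.
Context {R : realType}.
Notation mu := (@lebesgue_measure R).
Notation circle := (`[(- pi)%R, pi[%classic : set R).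
Implicit Types (X Y : set R) (f g : R -> R) (k : int).

Lemma continuous_cosM (u : R) : continuous (fun x => cos (u * x)).
Proof.
move=> x; apply: (continuous_comp (f := fun x => u * x)).
  by apply: cvgM; [exact: cvg_cst|exact: cvg_id].
exact: continuous_cos.
Qed.

Lemma continuous_sinM (u : R) : continuous (fun x => sin (u * x)).
Proof.
move=> x; apply: (continuous_comp (f := fun x => u * x)).
  by apply: cvgM; [exact: cvg_cst|exact: cvg_id].
exact: continuous_sin.
Qed.

Lemma MVT_lipschitz1 f (df : R -> R) :
  (forall x : R, is_derive x 1 f (df x)) -> (forall x, `|df x| <= 1) ->
  forall x y, `|f x - f y| <= `|x - y|.
Proof.
move=> fdf df1 x y; wlog yx : x y / y <= x => [hw|].
  by case: (leP y x) => [/hw //|/ltW/hw]; rewrite distrC [leRHS]distrC.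
have [|c _ ->] := MVT_segment yx (fun z _ => fdf z).
  apply: continuous_subspaceT => z.
  have [dfz _] := fdf z.
  exact/differentiable_continuous/derivable1_diffP.
by rewrite normrM ler_piMl.
Qed.

Lemma cosM_lipschitz (u x y : R) :
  `|cos (u * x) - cos (u * y)| <= `|u| * `|x - y|.
Proof.
rewrite -normrM mulrBr; apply: (MVT_lipschitz1 cos (fun x => - sin x)).
by move=> z; rewrite normrN ler_norml sin_geN1 sin_le1.
Qed.

Lemma sinM_lipschitz (u x y : R) :
  `|sin (u * x) - sin (u * y)| <= `|u| * `|x - y|.
Proof.
rewrite -normrM mulrBr; apply: (MVT_lipschitz1 sin cos).
by move=> z; rewrite ler_norml cos_geN1 cos_le1.
Qed.

(** [fcos X k - i fsin X k] is the integral of e^(-ikx) over [X], without the factor 1/(2 pi). *)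
Definition fcos X k : R := \int[mu]_(x in X) cos (k%:~R * x).
Definition fsin X k : R := \int[mu]_(x in X) sin (k%:~R * x).

Lemma fcosU X Y k : arcset X -> arcset Y -> X `&` Y = set0 ->
  fcos (X `|` Y) k = fcos X k + fcos Y k.
Proof.
by move=> *; rewrite /fcos Rintegral_arcsetU//; exact: continuous_cosM.
Qed.

Lemma fsinU X Y k : arcset X -> arcset Y -> X `&` Y = set0 ->
  fsin (X `|` Y) k = fsin X k + fsin Y k.
Proof.
by move=> *; rewrite /fsin Rintegral_arcsetU//; exact: continuous_sinM.
Qed.

Lemma fcosN X k : fcos X (- k) = fcos X k.
Proof. by apply: eq_Rintegral => x _; rewrite mulrNz mulNr cosN. Qed.

Lemma fsinN X k : arcset X -> fsin X (- k) = - fsin X k.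
Proof.
move=> aX; rewrite -[RHS]mulN1r -RintegralZl_arcset//.
  by apply: eq_Rintegral => x _; rewrite mulrNz mulNr sinN mulN1r.
exact: continuous_sinM.
Qed.

Lemma fcos0 X : measurable X -> fcos X 0 = fine (mu X).
Proof.
move=> mX; rewrite /fcos -[RHS]mul1r -Rintegral_cst//.
by apply: eq_Rintegral => x _; rewrite mul0r cos0.
Qed.

Lemma fsin0 X : measurable X -> fsin X 0 = 0.
Proof.
move=> mX; rewrite -[RHS](mul0r (fine (mu X))) -Rintegral_cst//.
by apply: eq_Rintegral => x _; rewrite mul0r sin0.
Qed.

Lemma Rintegral_circle_FTC f (F : R -> R) : continuous f ->
  (forall x : R, is_derive x 1 F (f x)) ->
  \int[mu]_(x in circle) f x = F pi - F (- pi).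
Proof.
move=> cf dF; have pi0 := @pi_gt0 R.
have dF1 x : derivable F x 1 by have [] := dF x.
have cF x : {for x, continuous F}.
  exact/differentiable_continuous/derivable1_diffP.
rewrite Rintegral_itv_bndo_bndc; last first.
  by apply: integrable_arcset => //; exact: arcset_circle.
rewrite /Rintegral (@continuous_FTC2 _ f F)//.
- by lra.
- exact: continuous_subspaceT.
- split=> //; [exact/cvg_at_right_filter/cF|exact/cvg_at_left_filter/cF].
- by move=> x _; rewrite derive1E; have [_ ->] := dF x.
Qed.

Lemma fcos_circle k : fcos circle k = if k == 0 then 2 * pi else 0.
Proof.
case: eqP => [->|/eqP k0].
  rewrite fcos0// fine_measure_itvco; first by ring.
  by have := @pi_gt0 R; lra.
have k0' : k%:~R != 0 :> R by rewrite intr_eq0.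
have dF (x : R) : is_derive x 1 (fun x => k%:~R^-1 * sin (k%:~R * x))
    (cos (k%:~R * x)).
  apply: is_derive_eq.
  by rewrite /GRing.scale/=; field.
rewrite /fcos (Rintegral_circle_FTC _ _ (continuous_cosM _) dF).
by rewrite mulrN sinN sin_intmul_pi oppr0 mulr0 subrr.
Qed.

Lemma fsin_circle k : fsin circle k = 0.
Proof.
have [->|k0] := eqVneq k 0; first by rewrite fsin0.
have k0' : k%:~R != 0 :> R by rewrite intr_eq0.
have dF (x : R) : is_derive x 1 (fun x => - (k%:~R^-1) * cos (k%:~R * x))
    (sin (k%:~R * x)).
  apply: is_derive_eq.
  by rewrite /GRing.scale/=; field.
rewrite /fsin (Rintegral_circle_FTC _ _ (continuous_sinM _) dF).
by rewrite mulrN cosN subrr.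
Qed.

End FourierCoefficients.

(** * The bilinear form E_L and its lower bound on a halved interval *)

Section Overlap.
Context {R : realType}.
Notation mu := (@lebesgue_measure R).
Notation circle := (`[(- pi)%R, pi[%classic : set R).
Implicit Types (X Y Z : set R) (f g : R -> R) (k : int).

(** Over all pairs [p], these are the frequencies, with multiplicity, of the squared modulus of the
    Dirichlet kernel. *)
Definition freq (L : nat) (p : 'I_L * 'I_L) : int :=
  (p.2 : nat)%:Z - (p.1 : nat)%:Z.

(** This is E_L on the Fourier side: each summand is the real part of the coefficient of [X] times
    the conjugate of that of [Y]. *)
Definition overlap (L : nat) X Y : R :=
  \sum_(p : 'I_L * 'I_L)
    (fcos X (freq L p) * fcos Y (freq L p) +
     fsin X (freq L p) * fsin Y (freq L p)).

Lemma overlapC L X Y : overlap L X Y = overlap L Y X.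
Proof. by apply: eq_bigr => p _; congr (_ + _); rewrite mulrC. Qed.

Lemma overlapUl L X Y Z : arcset X -> arcset Y -> X `&` Y = set0 ->
  overlap L (X `|` Y) Z = overlap L X Z + overlap L Y Z.
Proof.
move=> aX aY XY; rewrite /overlap -big_split/=; apply: eq_bigr => p _.
by rewrite fcosU// fsinU//; ring.
Qed.

Lemma overlapUr L X Y Z : arcset X -> arcset Y -> X `&` Y = set0 ->
  overlap L Z (X `|` Y) = overlap L Z X + overlap L Z Y.
Proof. by move=> *; rewrite overlapC overlapUl// !(overlapC _ Z). Qed.

Lemma continuous_bigsum (I : Type) (s : seq I) (F : I -> R -> R) :
  (forall i, continuous (F i)) -> continuous (fun x => \sum_(i <- s) F i x).
Proof.
move=> cF; elim: s => [|i s IHs].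
  by under eq_fun do rewrite big_nil; exact: cst_continuous.
under eq_fun do rewrite big_cons.
by move=> x; apply: cvgD; [exact: cF|exact: IHs].
Qed.

Lemma Rintegral_sum_arcset X (I : Type) (s : seq I) (F : I -> R -> R) :
  arcset X -> (forall i, continuous (F i)) ->
  \int[mu]_(x in X) (\sum_(i <- s) F i x) =
  \sum_(i <- s) \int[mu]_(x in X) F i x.
Proof.
move=> aX cF; elim: s => [|i s IHs].
  rewrite big_nil -[RHS](mul0r (fine (mu X))) -Rintegral_cst//;
    last by case: aX.
  by apply: eq_Rintegral => x _; rewrite big_nil.
rewrite big_cons -IHs -RintegralD_arcset//; last exact: continuous_bigsum.
by apply: eq_Rintegral => x _; rewrite big_cons.
Qed.

Lemma continuous_trig (c s u : R) :
  continuous (fun x => c * cos (u * x) + s * sin (u * x)).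
Proof.
move=> x; apply: cvgD; (apply: cvgM; first exact: cvg_cst).
  exact: continuous_cosM.
exact: continuous_sinM.
Qed.

Lemma Rintegral_trig X (c s : R) k : arcset X ->
  \int[mu]_(x in X) (c * cos (k%:~R * x) + s * sin (k%:~R * x)) =
  c * fcos X k + s * fsin X k.
Proof.
move=> aX; rewrite RintegralD_arcset//; first rewrite !RintegralZl_arcset//.
- exact: continuous_sinM.
- exact: continuous_cosM.
- by move=> x; apply: cvgM; [exact: cvg_cst|exact: continuous_cosM].
- by move=> x; apply: cvgM; [exact: cvg_cst|exact: continuous_sinM].
Qed.

(* The sum is the squared modulus of the Dirichlet kernel [\sum_k e^{i k t}]. *)
Lemma sum_cos_freq_ge0 L (t : R) :
  0 <= \sum_(p : 'I_L * 'I_L) cos ((freq L p)%:~R * t).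
Proof.
suff -> : \sum_(p : 'I_L * 'I_L) cos ((freq L p)%:~R * t) =
  (\sum_(k < L) cos (k%:R * t)) ^+ 2 + (\sum_(k < L) sin (k%:R * t)) ^+ 2.
  by rewrite addr_ge0// sqr_ge0.
rewrite !expr2 !big_distrlr/= !pair_bigA -big_split/=; apply: eq_bigr => p _.
by rewrite /freq mulrzBr -!pmulrn mulrBl cosB; ring.
Qed.

(* [overlap L X Y] is the integral over [X * Y] of the squared modulus of the
   Dirichlet kernel at [a - b]. *)
Lemma overlap_ge0 L X Y : arcset X -> arcset Y -> 0 <= overlap L X Y.
Proof.
move=> aX aY; rewrite /overlap.
(* The sum is finite, so linearity alone moves it under the integral over [X], and then, for fixed
   [a], under the one over [Y]. *)
under eq_bigr do
  rewrite ![fcos X _ * _]mulrC ![fsin X _ * _]mulrC -Rintegral_trig//.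
rewrite -Rintegral_sum_arcset//; last by move=> p; exact: continuous_trig.
apply: Rintegral_ge0 => a _.
under eq_bigr do
  rewrite ![fcos Y _ * _]mulrC ![fsin Y _ * _]mulrC -Rintegral_trig//.
rewrite -Rintegral_sum_arcset//; last by move=> p; exact: continuous_trig.
apply: Rintegral_ge0 => b _.
under eq_bigr do rewrite -cosB -mulrBr.
exact: sum_cos_freq_ge0.
Qed.

(** By additivity the difference of the two sides is the overlap of [Y \ X] with [Z], which is
    nonnegative. *)
Lemma le_overlapl L X Y Z : arcset X -> arcset Y -> arcset Z ->
  X `<=` Y -> overlap L X Z <= overlap L Y Z.
Proof.
move=> aX aY aZ XY; rewrite -(setDUK XY) overlapUl//; last 2 first.
- by apply: arcsetD => //; case: aX.
- exact: setDIK.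
by rewrite lerDl overlap_ge0//; apply: arcsetD => //; case: aX.
Qed.

Lemma le_overlap L X Y X' Y' : arcset X -> arcset Y -> arcset X' -> arcset Y' ->
  X `<=` X' -> Y `<=` Y' -> overlap L X Y <= overlap L X' Y'.
Proof.
move=> aX aY aX' aY' XX' YY'; apply: (@le_trans _ _ (overlap L X' Y)).
  exact: le_overlapl.
by rewrite ![overlap L X' _]overlapC; exact: le_overlapl.
Qed.

Lemma freq_eq0 L (p : 'I_L * 'I_L) : (freq L p == 0) = (p.2 == p.1).
Proof. by rewrite subr_eq0. Qed.

Lemma sum_diag L (x : R) :
  \sum_(p : 'I_L * 'I_L) (if freq L p == 0 then x else 0) = L%:R * x.
Proof.
under eq_bigr do rewrite freq_eq0.
rewrite -(pair_bigA _ (fun i j : 'I_L => if j == i then x else 0))/=.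
under eq_bigr do rewrite -big_mkcond big_pred1_eq.
by rewrite sumr_const card_ord mulr_natl.
Qed.

(** Only the zero frequency of the circle survives, and [L] pairs attain it. *)
Lemma overlap_circle L X : arcset X ->
  overlap L X circle = L%:R * (2 * pi * fine (mu X)).
Proof.
move=> aX; rewrite -sum_diag; apply: eq_bigr => p _.
rewrite fsin_circle fcos_circle mulr0 addr0; case: eqP => [->|];
  last by rewrite mulr0.
by rewrite fcos0 1?mulrC//; case: aX.
Qed.

Lemma overlap_compl L X : arcset X ->
  overlap L X (circle `\` X) = L%:R * (2 * pi * fine (mu X)) - overlap L X X.
Proof.
move=> aX; rewrite -overlap_circle//.
have -> : overlap L X circle = overlap L X X + overlap L X (circle `\` X).
  rewrite -overlapUr ?setDUK//; [by case: aX| |exact: setDIK].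
  by apply: arcsetD; [exact: arcset_circle|case: aX].
by rewrite addrC addKr.
Qed.

(** Polarization, 4xy = (x + y)^2 - (x - y)^2, at each frequency. *)
Lemma overlap_halves L X Y : arcset X -> arcset Y -> X `&` Y = set0 ->
  overlap L X Y = 4^-1 * (overlap L (X `|` Y) (X `|` Y) -
    \sum_(p : 'I_L * 'I_L) ((fcos X (freq L p) - fcos Y (freq L p)) ^+ 2 +
                            (fsin X (freq L p) - fsin Y (freq L p)) ^+ 2)).
Proof.
move=> aX aY XY; rewrite /overlap -sumrB big_distrr/=; apply: eq_bigr => p _.
by rewrite fcosU// fsinU//; field.
Qed.

(** All terms are sums of squares; keep only the [L] pairs of frequency zero. *)
Lemma overlap_diag_ge L X : arcset X ->
  L%:R * fine (mu X) ^+ 2 <= overlap L X X.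
Proof.
move=> aX; rewrite -sum_diag; apply: ler_sum => p _; rewrite -!expr2.
case: eqP => [->|_]; last by rewrite addr_ge0// sqr_ge0.
by rewrite fcos0 ?lerDl ?sqr_ge0//; case: aX.
Qed.

Lemma normr_freq_le L (p : 'I_L * 'I_L) : `|(freq L p)%:~R| <= L%:R :> R.
Proof.
rewrite /freq mulrzBr -!pmulrn ler_norml.
have h1 : p.1%:R <= L%:R :> R by rewrite ler_nat ltnW.
have h2 : p.2%:R <= L%:R :> R by rewrite ler_nat ltnW.
have h3 := ler0n R p.1; have h4 := ler0n R p.2.
by apply/andP; lra.
Qed.

(** Polarization gives a quarter of a main term, at least L d^2, minus an error from the coefficient
    differences. Fine halving makes the error at most half of L d^2, whence the constant 1/8. The
    modes involved are [K]-Lipschitz, so one [X] serves all [L <= K]. *)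
Lemma overlap_halving (K : nat) (a b : R) :
  a <= b -> `[a, b[%classic `<=` circle ->
  exists X, [/\ measurable X, X `<=` `[a, b[%classic &
   forall L, (L <= K)%N ->
     L%:R * (b - a) ^+ 2 / 8 <= overlap L X (`[a, b[%classic `\` X)].
Proof.
move=> ab abc; set d := b - a; have d0 : 0 <= d by rewrite subr_ge0.
have aI : arcset `[a, b[%classic by split.
(* This depth makes [2 * K * eta <= d] below, where [eta] bounds each difference of coefficients of
   [X] and [Y]. *)
pose j := Num.bound (2 * K%:R ^+ 2 * d).
have jP : 2 * K%:R ^+ 2 * d <= 2 ^+ j by apply/ltW/upper_nthrootP.
have [X [mX sX hX]] := halving_set K%:R j a b ab abc.
exists X; split=> // L LK; set Y := _ `\` X.
have aX : arcset X by split=> // x /sX/abc.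
have aY : arcset Y by exact: arcsetD.
rewrite overlap_halves//; last by exact: setDIK.
have XYE : X `|` Y = `[a, b[%classic by exact: setDUK.
have big : L%:R * d ^+ 2 <= overlap L (X `|` Y) (X `|` Y).
  by rewrite XYE; have := overlap_diag_ge L _ aI; rewrite fine_measure_itvco.
set eta := K%:R * d ^+ 2 / 2 ^+ j.
have eta0 : 0 <= eta by rewrite !mulr_ge0// ?sqr_ge0// invr_ge0 exprn_ge0.
have LK' : L%:R <= K%:R :> R by rewrite ler_nat.
have small : \sum_(p : 'I_L * 'I_L)
  ((fcos X (freq L p) - fcos Y (freq L p)) ^+ 2 +
   (fsin X (freq L p) - fsin Y (freq L p)) ^+ 2) <= 2 * L%:R ^+ 2 * eta ^+ 2.
  have -> : 2 * L%:R ^+ 2 * eta ^+ 2 =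
      \sum_(p : 'I_L * 'I_L) (eta ^+ 2 + eta ^+ 2).
    rewrite sumr_const card_prod card_ord -[RHS]mulr_natl natrM; ring.
  apply: ler_sum => p _; apply: lerD; rewrite -[leLHS]real_normK ?num_real//;
    rewrite ler_sqr ?nnegrE//; apply: hX.
  - exact: continuous_cosM.
  - move=> x y; apply: (le_trans (cosM_lipschitz _ _ _)).
    by rewrite ler_wpM2r// (le_trans (normr_freq_le L p)).
  - exact: continuous_sinM.
  - move=> x y; apply: (le_trans (sinM_lipschitz _ _ _)).
    by rewrite ler_wpM2r// (le_trans (normr_freq_le L p)).
have etaK : 2 * K%:R * eta <= d.
  have -> : 2 * K%:R * eta = (2 * K%:R ^+ 2 * d) / 2 ^+ j * d.
    by rewrite /eta; ring.
  by rewrite ler_piMl// ler_pdivrMr ?exprn_gt0// mul1r.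
(* For [L > 0] one has 1 <= K, so L <= K <= K^2 and 4 L eta^2 <= (2 K eta)^2 <= d^2. The case
   [L = 0] is separate since [K] may then be 0. *)
have key : 2 * L%:R ^+ 2 * eta ^+ 2 <= L%:R * d ^+ 2 / 2.
  case: L LK LK' {big small} => [|L] LK LK'.
    by rewrite expr0n/= !(mulr0, mul0r).
  have K1 : 1 <= K%:R :> R by rewrite ler1n (leq_trans _ LK).
  have h : (2 * K%:R * eta) ^+ 2 <= d ^+ 2.
    by rewrite ler_sqr ?nnegrE// mulr_ge0// mulr_ge0.
  have h2 : L.+1%:R * eta ^+ 2 <= K%:R ^+ 2 * eta ^+ 2.
    rewrite ler_wpM2r ?sqr_ge0// (le_trans LK')// expr2 ler_peMl//.
  have h3 : 4 * (L.+1%:R * eta ^+ 2) <= d ^+ 2.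
    apply: le_trans h.
    have -> : (2 * K%:R * eta) ^+ 2 = 4 * (K%:R ^+ 2 * eta ^+ 2) by ring.
    by rewrite ler_pM2l.
  have h4 := ler_wpM2l (ler0n R L.+1) h3.
  have -> : 2 * L.+1%:R ^+ 2 * eta ^+ 2 =
      L.+1%:R * (4 * (L.+1%:R * eta ^+ 2)) / 2.
    by field.
  by rewrite ler_pM2r// invr_gt0.
move: big small key; lra.
Qed.

End Overlap.

(** * A set of the circle whose overlap with its complement dominates a given o(L) *)

Section SlowSet.
Context {R : realType}.
Notation circle := (`[(- pi)%R, pi[%classic : set R).

(** The intervals I_n; they tile (0, 1), which lies in the circle because 1 < pi. *)
Definition slot (n : nat) : set R := `[n.+2%:R^-1, n.+1%:R^-1[%classic.

Lemma slot_disjoint n m (x : R) : slot n x -> slot m x -> n = m.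
Proof.
wlog nm : n m / (n <= m)%N => [hw|].
  by case: (leqP n m) => [/hw //|/ltnW/hw h ? ?]; apply/esym/h.
move: nm; rewrite leq_eqVlt => /predU1P[//|nm].
rewrite /slot /= !in_itv/= => /andP[nx _] /andP[_ xm].
have : m.+1%:R^-1 <= n.+2%:R^-1 :> R by rewrite lef_pV2 ?posrE// ler_nat.
by move=> h; have := lt_le_trans xm (le_trans h nx); rewrite ltxx.
Qed.

Lemma slot_circle n : slot n `<=` circle.
Proof.
move=> x; rewrite /slot /= !in_itv/= => /andP[x1 x2].
have h1 : 0 <= n.+2%:R^-1 :> R by rewrite invr_ge0.
have h2 : n.+1%:R^-1 <= 1 :> R by rewrite invf_le1// ler1n.
have x0 : 0 <= x := le_trans h1 x1; have x3 : x < 1 := lt_le_trans x2 h2.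
by have h3 := @pi_ge2 R; apply/andP; lra.
Qed.

Lemma slow_set (eps : nat -> R) : eps @ \oo --> (0 : R) ->
  exists M, arcset M /\
    \forall L \near \oo, L%:R * eps L <= overlap L M (circle `\` M).
Proof.
move=> eps0; pose len n : R := n.+1%:R^-1 - n.+2%:R^-1.
have len0 n : 0 < len n by rewrite subr_gt0 ltf_pV2 ?posrE// ltr_nat.
(* The condition [n <= k] makes [K] unbounded, so that only finitely many [n] satisfy [K n <= L]. *)
have /choice[K KP] n : exists k, (n <= k)%N /\
    forall L, (k <= L)%N -> eps L <= len n ^+ 2 / 8.
  have e0 : 0 < len n ^+ 2 / 8 by rewrite divr_gt0// exprn_gt0.
  have /cvgrPdist_le/(_ _ e0)[N _ NP] := eps0.
  exists (maxn n N); split; first exact: leq_maxl.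
  move=> L; rewrite geq_max => /andP[_ /NP/=].
  by rewrite sub0r normrN; exact: le_trans (ler_norm _).
(* Slot [n] has to serve every [L] from [K n] to [K n.+1], hence the scale [K n.+1]. *)
have /choice[X XP] n := @overlap_halving R (K n.+1) n.+2%:R^-1 n.+1%:R^-1
  (ltW (eq_ind _ is_true (len0 n) _ (subr_gt0 _ _))) (@slot_circle n).
have aX n : arcset (X n).
  by have [mX sX _] := XP n; split=> // x /sX/(slot_circle n).
have mM : measurable (\bigcup_n X n).
  by apply: bigcup_measurable => n _; case: (aX n).
have aM : arcset (\bigcup_n X n) by split=> // x [n _] /(aX n).2.
exists (\bigcup_n X n); split=> //; exists (K 0) => // L /= KL.
have exn : exists n, (K n <= L)%N by exists 0%N.
have bdn n : (K n <= L)%N -> (n <= L)%N by apply: leq_trans; case: (KP n).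
(* Slot [n] is the last one with [K n <= L]; maximality yields [L <= K n.+1]. *)
case: (ex_maxnP exn bdn) => n KnL nmax.
have LK : (L <= K n.+1)%N.
  by rewrite leqNgt; apply/negP => /ltnW/nmax; rewrite ltnn.
have [mX sX hX] := XP n.
apply: (@le_trans _ _ (L%:R * (len n ^+ 2 / 8))).
  by rewrite ler_wpM2l//; apply: (KP n).2.
rewrite mulrA; apply: (le_trans (hX L LK)).
have aS : arcset (slot n) by split; [exact: measurable_itv|exact: slot_circle].
apply: le_overlap => //.
- exact: arcsetD.
- by apply: arcsetD => //; exact: arcset_circle.
- exact: bigcup_sup.
(* A point of slot [n] outside [X n] is in no other [X m] either, the slots being disjoint. *)
- move=> x [Sx nXx]; split; first exact: (slot_circle n).
  move=> [m _ Xmx]; have [_ sXm _] := XP m.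
  by have e := slot_disjoint _ _ _ Sx (sXm x Xmx); rewrite e in nXx.
Qed.

End SlowSet.

(** * Trigonometric integrals over the cube and over cylinders *)

Section CubeIntegral.
Context {R : realType}.
Notation mu := (@lebesgue_measure R).
Notation circle := (`[(- pi)%R, pi[%classic : set R).

Lemma torus_cube_cons n (x : R) (t : n.-tuple R) :
  circle x -> torus_cube t -> torus_cube (cons_tuple x t).
Proof.
rewrite /= in_itv/= => /andP[x1 x2] ct i.
by case: (unliftP ord0 i) => [j ->|->]; rewrite ?tnthS ?tnth0//; exact: ct.
Qed.

Lemma eq_cube_integral n (f g : n.-tuple R -> R) :
  (forall a, torus_cube a -> f a = g a) -> cube_integral f = cube_integral g.
Proof.
elim: n f g => [|n IHn] f g fg /=; first by apply: fg => -[].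
apply: eq_Rintegral => x /set_mem cx; apply: IHn => t ct.
by apply: fg; exact: torus_cube_cons.
Qed.

Lemma dotZR_cons n (m : 'I_n.+1 -> int) (x : R) (t : n.-tuple R) :
  dotZR m (cons_tuple x t) =
  (m ord0)%:~R * x + dotZR (fun i => m (lift ord0 i)) t.
Proof.
rewrite /dotZR big_ord_recl tnth0; congr (_ + _).
by apply: eq_bigr => i _; rewrite tnthS.
Qed.

(** For fixed first coordinate, the addition formulas turn the integrand into one of the same shape
    in the other coordinates, with new [A] and [B]. Carrying both cosine and sine makes the
    induction close. *)
Lemma cube_integral_trig n (m : 'I_n -> int) (A B : R) :
  cube_integral
    (fun a : n.-tuple R => A * cos (dotZR m a) + B * sin (dotZR m a)) =
  if [forall i, m i == 0] then (2 * pi) ^+ n * A else 0.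
Proof.
elim: n m A B => [|n IHn] m A B /=.
  rewrite /dotZR big_ord0 cos0 sin0 mulr1 mulr0 addr0 expr0 mul1r.
  by case: forallP => // -[] [].
set m' := fun i => m (lift ord0 i); set u := (m ord0)%:~R : R.
have inner x : cube_integral (fun t : n.-tuple R =>
    A * cos (dotZR m (cons_tuple x t)) + B * sin (dotZR m (cons_tuple x t))) =
  if [forall i, m' i == 0] then
    ((2 * pi) ^+ n * A) * cos (u * x) + ((2 * pi) ^+ n * B) * sin (u * x)
  else 0.
  have -> : (fun t : n.-tuple R => A * cos (dotZR m (cons_tuple x t)) +
      B * sin (dotZR m (cons_tuple x t))) =
    (fun t => (A * cos (u * x) + B * sin (u * x)) * cos (dotZR m' t) +
      (B * cos (u * x) - A * sin (u * x)) * sin (dotZR m' t)).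
    by apply/funext => t; rewrite dotZR_cons cosD sinD -/u -/m'; ring.
  by rewrite IHn; case: ifP => // _; ring.
rewrite (eq_Rintegral mu (fun x _ => inner x)).
have -> : [forall i, m i == 0] = (m ord0 == 0) && [forall i, m' i == 0].
  apply/forallP/andP => [h|[h0 /forallP h] i].
    by split; [exact: h|apply/forallP => i; exact: h].
  by case: (unliftP ord0 i) => [j ->|->] //; exact: h.
case: [forall i, m' i == 0]; last first.
  by rewrite andbF Rintegral_cst// mul0r.
rewrite andbT Rintegral_trig; last exact: arcset_circle.
rewrite fcos_circle fsin_circle mulr0 addr0 exprS.
by case: ifP => _; [ring|rewrite mulr0].
Qed.

Definition cylinder d (M : set R) : set (d.+1.-tuple R) :=
  [set a | torus_cube a /\ M (tnth a ord0)].

Lemma measurable_cylinder d M : measurable M -> measurable (cylinder d M).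
Proof.
move=> mM.
have -> : cylinder d M =
    (\bigcap_(i in [set: 'I_d.+1]) ((fun a => tnth a i) @^-1` circle))
    `&` ((fun a => tnth a ord0) @^-1` M).
  apply/seteqP; split=> [a [ca Ma]|a [ca Ma]]; split=> //.
    by move=> i _ /=; rewrite in_itv/=; apply/andP; exact: ca.
  by move=> i; have := ca i I; rewrite /= in_itv/= => /andP[].
apply: measurableI.
  apply: fin_bigcap_measurable => // i _.
  by rewrite -[X in measurable X]setTI; apply: measurable_tnth.
by rewrite -[X in measurable X]setTI; apply: measurable_tnth.
Qed.

Lemma chi_cylinder_cons d M (x : R) (t : d.-tuple R) :
  circle x -> torus_cube t ->
  chi R (cylinder d M) (cons_tuple x t) = chi R M x.
Proof.
move=> cx ct; rewrite /chi; congr (if _ then _ else _).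
apply: asbool_equiv_eq; rewrite /cylinder /= tnth0.
split=> [[]//|Mx]; split=> //.
exact: torus_cube_cons.
Qed.

Lemma Rintegral_chi (M : set R) (f : R -> R) : M `<=` circle ->
  \int[mu]_(x in circle) (chi R M x * f x) = \int[mu]_(x in M) f x.
Proof.
move=> sM; rewrite -{2}(setIidr sM) Rintegral_mkcondr.
apply: eq_Rintegral => x _; rewrite patchE /chi -/(x \in M).
have -> : `[< M x >] = (x \in M) by [].
by case: ifP; rewrite (mul1r, mul0r).
Qed.

(** For fixed first coordinate the indicator is constant on the cube of the other coordinates, whose
    integral therefore vanishes unless all their frequencies are zero. *)
Lemma cube_integral_cylinder d (M : set R) (m : 'I_d.+1 -> int) (A B : R) :
  arcset M ->
  cube_integral (fun a => chi R (cylinder d M) a *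
    (A * cos (dotZR m a) + B * sin (dotZR m a))) =
  if [forall i : 'I_d, m (lift ord0 i) == 0] then
    (2 * pi) ^+ d * (A * fcos M (m ord0) + B * fsin M (m ord0)) else 0.
Proof.
move=> aM; have [mM sM] := aM; set u := (m ord0)%:~R : R.
pose m' (i : 'I_d) := m (lift ord0 i).
transitivity (\int[mu]_(x in circle) (chi R M x *
  (if [forall i, m' i == 0] then
    (2 * pi) ^+ d * (A * cos (u * x) + B * sin (u * x)) else 0))).
  apply: eq_Rintegral => x /set_mem cx.
  transitivity (cube_integral (fun t : d.-tuple R =>
      (chi R M x * (A * cos (u * x) + B * sin (u * x))) * cos (dotZR m' t) +
      (chi R M x * (B * cos (u * x) - A * sin (u * x))) * sin (dotZR m' t))).
    apply: eq_cube_integral => t ct.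
    rewrite chi_cylinder_cons// dotZR_cons cosD sinD -/u -/m'; ring.
  by rewrite cube_integral_trig; case: ifP => _; [ring|rewrite mulr0].
rewrite Rintegral_chi//; case: [forall i, m' i == 0]; last first.
  by rewrite Rintegral_cst// mul0r.
rewrite RintegralZl_arcset//; last exact: continuous_trig.
by rewrite Rintegral_trig.
Qed.

End CubeIntegral.

(** * Lower bound of the entropy by a quadratic trace *)

Section Entropy.
Context {R : realType}.

(* As [ln] is [0] on nonpositive reals, this holds outside [0, 1] too, so the
   bounds [0 <= Q_L <= 1] are not needed. *)
Lemma hbin_ge (x : R) : 2 * (x * (1 - x)) <= hbin x.
Proof.
(* For y > 0 this is ln y <= y - 1 = -z multiplied by y. Used at x and at 1 - x, it gives the two
   halves of the claim. *)
have xlnx_le (y z : R) : y + z = 1 -> y != 0 -> xlnx y <= - (y * z).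
  move=> yz y0; rewrite /xlnx (negPf y0).
  have [yn|yp] := ltP y 0.
    rewrite ln0 ?mulr0; last exact: ltW.
    by rewrite oppr_ge0 mulr_le0_ge0//; lra.
  have yp' : 0 < y by rewrite lt_neqAle eq_sym y0.
  have /(ler_wpM2l yp) : ln y <= - z.
    have -> : y = 1 + - z by lra.
    by apply: le_ln1Dx; lra.
  by rewrite mulrN.
rewrite /hbin; have [->|x0] := eqVneq x 0.
  by rewrite /xlnx eqxx subr0 oner_eq0 ln1; lra.
have [->|x1] := eqVneq x 1.
  by rewrite /xlnx subrr eqxx oner_eq0 ln1; lra.
have h1 := xlnx_le x (1 - x) (subrKC _ _) x0.
have h2 := xlnx_le (1 - x) x (subrK _ _) _.
have {}h2 : xlnx (1 - x) <= - ((1 - x) * x).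
  by apply: h2; rewrite subr_eq0 eq_sym.
lra.
Qed.

(** Diagonalization and cyclicity of the trace turn both traces into sums over the real eigenvalues,
    where [hbin_ge] applies termwise. *)
Lemma vN_entropy_ge n (A : 'M[R[i]]_n) : A \is hermsymmx ->
  2 * complex.Re (\tr A - \tr (A *m A)) <= vN_entropy A.
Proof.
move=> hA; have rA := hermitian_spectral_diag_real hA.
have /orthomx_spectralP AE := hermitian_normalmx hA.
set P := spectralmx A in AE; set D := spectral_diag A in AE rA *.
have uP : P \in unitmx by exact: spectral_unit.
have trA : \tr A = \sum_i D 0 i.
  by rewrite AE -mulmxA mxtrace_mulC -mulmxA mulmxV// mulmx1 mxtrace_diag.
have trAA : \tr (A *m A) = \sum_i D 0 i ^+ 2.
  rewrite AE -!mulmxA mxtrace_mulC -!mulmxA mulKVmx// mulmxV// mulmx1.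
  by rewrite mulmx_diag mxtrace_diag; apply: eq_bigr => i _; rewrite mxE expr2.
rewrite trA trAA -sumrB raddf_sum mulr_sumr; apply: ler_sum => i _.
have /mxOverP/(_ 0 i) := rA.
case: (D 0 i) => x y; rewrite complex_real => /eqP ->.
rewrite expr2/= mulr0 subr0 (_ : x - x * x = x * (1 - x)); last by ring.
exact: hbin_ge.
Qed.

End Entropy.

(** * Sums over the box, splitting off the first coordinate *)

Section Box.
Context {R : realType} (d L : nat).

Definition boxcons (k : 'I_L) (h : boxidx d L) : boxidx d.+1 L :=
  [ffun i => if unlift ord0 i is Some j then h j else k].

Lemma boxcons0 k h : boxcons k h ord0 = k.
Proof. by rewrite ffunE unlift_none. Qed.

Lemma boxconsS k h j : boxcons k h (lift ord0 j) = h j.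
Proof. by rewrite ffunE liftK. Qed.

Lemma sum_boxcons (G : boxidx d.+1 L -> R) :
  \sum_f G f = \sum_k \sum_h G (boxcons k h).
Proof.
rewrite pair_bigA/=.
apply: (reindex (fun p : 'I_L * boxidx d L => boxcons p.1 p.2)).
exists (fun f : boxidx d.+1 L => (f ord0, [ffun j : 'I_d => f (lift ord0 j)]))
  => [[k h] _|f _] /=.
  by rewrite boxcons0; congr pair; apply/ffunP => j; rewrite ffunE boxconsS.
apply/ffunP => i; case: (unliftP ord0 i) => [j ->|->].
  by rewrite boxconsS ffunE.
by rewrite boxcons0.
Qed.

(** Entries of [QL] for a cylinder vanish unless all coordinates after the first agree; the choices
    of these common coordinates give the factor [L ^ d]. *)
Lemma sum_box_agree (H : 'I_L * 'I_L -> R) :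
  \sum_(f : boxidx d.+1 L) \sum_(g : boxidx d.+1 L)
    (if [forall j : 'I_d, f (lift ord0 j) == g (lift ord0 j)]
     then H (f ord0, g ord0) else 0) =
  L%:R ^+ d * \sum_p H p.
Proof.
have -> : \sum_p H p = \sum_k \sum_l H (k, l).
  by rewrite pair_bigA; apply: eq_bigr => -[].
rewrite sum_boxcons mulr_sumr.
apply: eq_bigr => k _.
transitivity (\sum_(h : boxidx d L) \sum_(l < L) H (k, l)).
  apply: eq_bigr => h _; rewrite sum_boxcons; apply: eq_bigr => l _.
  rewrite -big_mkcond (big_pred1 h) ?boxcons0// => h'.
  apply/forallP/eqP => [e|-> j]; last by rewrite !boxconsS.
  by apply/ffunP => j; have := e j; rewrite !boxconsS => /eqP.
by rewrite sumr_const card_ffun !card_ord -natrX mulr_natl.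
Qed.

End Box.

(** * The matrix of a cylinder and its traces *)

Section TraceQL.
Context {R : realType}.
Notation mu := (@lebesgue_measure R).
Notation circle := (`[(- pi)%R, pi[%classic : set R).

(** Full periods in the last [d] coordinates contribute (2 pi)^d, leaving one factor 2 pi of the
    normalization. *)
Lemma Qsymbol_cylinder d (M : set R) (k l : 'I_d.+1 -> int) : arcset M ->
  Qsymbol (cylinder d M) k l =
  if [forall j : 'I_d, k (lift ord0 j) == l (lift ord0 j)] then
    Complex ((2 * pi)^-1 * fcos M (l ord0 - k ord0))
            (- ((2 * pi)^-1 * fsin M (l ord0 - k ord0)))
  else 0.
Proof.
move=> aM; rewrite /Qsymbol; set m := fun j : 'I_d.+1 => l j - k j.
have pi0 : 2 * pi != 0 :> R by rewrite mulf_neq0// gt_eqF// pi_gt0.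
have -> : (fun a : d.+1.-tuple R => chi R (cylinder d M) a * cos (dotZR m a)) =
    (fun a => chi R (cylinder d M) a *
      (1 * cos (dotZR m a) + 0 * sin (dotZR m a))).
  by apply/funext => a; rewrite mul1r mul0r addr0.
have -> : (fun a : d.+1.-tuple R => chi R (cylinder d M) a * sin (dotZR m a)) =
    (fun a => chi R (cylinder d M) a *
      (0 * cos (dotZR m a) + 1 * sin (dotZR m a))).
  by apply/funext => a; rewrite mul1r mul0r add0r.
rewrite !cube_integral_cylinder// !mul1r !mul0r addr0 add0r.
have -> : [forall j : 'I_d, m (lift ord0 j) == 0] =
    [forall j : 'I_d, k (lift ord0 j) == l (lift ord0 j)].
  by apply: eq_forallb => j; rewrite subr_eq0 eq_sym.
case: ifP => _; last by rewrite mulr0 oppr0.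
have pid : (2 * pi) ^+ d != 0 :> R by rewrite expf_neq0.
by rewrite !mulrA exprS invfM mulfVK.
Qed.

Lemma boxptB d L (f g : boxidx d L) j :
  boxpt g j - boxpt f j = freq L (f j, g j).
Proof. by rewrite /boxpt /freq !intS opprD addrACA subrr add0r. Qed.

Lemma boxpt_agree d L (f g : boxidx d.+1 L) :
  [forall j : 'I_d, boxpt f (lift ord0 j) == boxpt g (lift ord0 j)] =
  [forall j : 'I_d, f (lift ord0 j) == g (lift ord0 j)].
Proof. by apply: eq_forallb => j. Qed.

(** Exchanging the indices negates the frequency, which conjugates the entry: [fcos] is even and
    [fsin] odd. *)
Lemma QL_hermsym d (M : set R) L : arcset M ->
  QL (cylinder d M) L \is hermsymmx.
Proof.
move=> aM; apply/is_hermitianmxP; rewrite expr0 scale1r.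
apply/matrixP => p q; rewrite !mxE !Qsymbol_cylinder// -opprB fcosN fsinN//.
have -> : [forall j : 'I_d,
      boxpt (enum_val q) (lift ord0 j) == boxpt (enum_val p) (lift ord0 j)] =
    [forall j : 'I_d,
      boxpt (enum_val p) (lift ord0 j) == boxpt (enum_val q) (lift ord0 j)].
  by apply: eq_forallb => j; rewrite eq_sym.
case: ifP => _; last by rewrite conjC0.
by rewrite mulrN.
Qed.

(** The trace of Q counts equal diagonal entries, and that of Q^2 is the sum of all |Q_kl|^2, a
    multiple of [overlap L M M]; [overlap_compl] combines the two. *)
Lemma trace_QL d (M : set R) L : arcset M ->
  complex.Re (\tr (QL (cylinder d M) L) -
    \tr (QL (cylinder d M) L *m QL (cylinder d M) L)) =
  L%:R ^+ d / (2 * pi) ^+ 2 * overlap L M (circle `\` M).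
Proof.
move=> aM; have [mM _] := aM.
have pi0 : 2 * pi != 0 :> R by rewrite mulf_neq0// gt_eqF// pi_gt0.
have ReB (x y : R[i]) : complex.Re (x - y) = complex.Re x - complex.Re y.
  by case: x y => [? ?] [].
have Re_sum n (f : 'I_n -> R[i]) :
    complex.Re (\sum_i f i) = \sum_i complex.Re (f i).
  exact: raddf_sum.
rewrite ReB /mxtrace !Re_sum.
have -> : \sum_i complex.Re (QL (cylinder d M) L i i) =
    L%:R ^+ d.+1 / (2 * pi) * fine (mu M).
  under eq_bigr => i _.
    rewrite mxE Qsymbol_cylinder// subrr fcos0//.
    have -> : [forall j : 'I_d,
        boxpt (enum_val i) (lift ord0 j) == boxpt (enum_val i) (lift ord0 j)].
      by apply/forallP.
    over.
  rewrite /= sumr_const card_ord card_ffun !card_ord.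
  by rewrite -[LHS]mulr_natl natrX mulrA.
have -> : \sum_i complex.Re ((QL (cylinder d M) L *m QL (cylinder d M) L) i i) =
    L%:R ^+ d / (2 * pi) ^+ 2 * overlap L M M.
  rewrite -mulrA [X in _ = _ * X]mulr_sumr -sum_box_agree.
  (* Both box sums are reindexed by the matrix indices that enumerate the box. *)
  rewrite [RHS](reindex_onto enum_val enum_rank)/=;
    last by move=> *; exact: enum_rankK.
  apply: eq_big => [i|i _]; first by rewrite enum_valK eqxx.
  rewrite mxE Re_sum.
  rewrite [RHS](reindex_onto enum_val enum_rank)/=;
    last by move=> *; exact: enum_rankK.
  apply: eq_big => [j|j _]; first by rewrite enum_valK eqxx.
  rewrite !mxE !Qsymbol_cylinder// !boxpt_agree.
  have -> : [forall k : 'I_d,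
        enum_val j (lift ord0 k) == enum_val i (lift ord0 k)] =
      [forall k : 'I_d, enum_val i (lift ord0 k) == enum_val j (lift ord0 k)].
    by apply: eq_forallb => k; rewrite eq_sym.
  case: ifP => _; last by rewrite mul0r.
  rewrite -[boxpt (enum_val i) ord0 - _]opprB fcosN fsinN// boxptB -exprVn.
  by move: (2 * pi)^-1 => c /=; ring.
rewrite overlap_compl// exprS; move: (2 * pi) pi0 => c c0; field.
exact: c0.
Qed.

End TraceQL.

Theorem theorem2 (R : realType) (d : nat) (F : nat -> R) :
  (0 < d)%N ->
  (forall L : nat, 0 < F L) ->
  (fun L : nat => F L / (L%:R ^+ d)) @ \oo --> (0 : R)%R ->
  exists M : set (d.-tuple R),
    [/\ measurable M, M `<=` @torus_cube R d &
        \forall L \near \oo, F L <= S_L M L].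
Proof.
(* From here the dimension is [d.+1], which provides a first coordinate. *)
case: d => // d _ _ F0.
have pi0 : 0 < pi :> R := pi_gt0 R.
(* The constant inverts the prefactor 2 / (2 pi)^2 = 1 / (2 pi^2) of the entropy bound, so that the
   final estimate returns exactly [F L]. *)
have eps0 : (fun L => 2 * pi ^+ 2 * (F L / L%:R ^+ d.+1)) @ \oo --> (0 : R).
  by rewrite -(mulr0 (2 * pi ^+ 2 : R)); apply: cvgM => //; exact: cvg_cst.
have [M [aM HM]] := slow_set _ eps0.
exists (cylinder d M); split.
- by apply: measurable_cylinder; case: aM.
- by move=> a [].
near=> L.
have L0 : (0 < L)%N by near: L; exact: nbhs_infty_gt.
have L0' : L%:R != 0 :> R by rewrite pnatr_eq0 -lt0n.
apply: (le_trans _ (vN_entropy_ge _ _ (QL_hermsym d M L aM))).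
rewrite trace_QL//.
have h : L%:R * (2 * pi ^+ 2 * (F L / L%:R ^+ d.+1)) <=
    overlap L M (`[- pi, pi[%classic `\` M).
  by near: L.
have c0 : 0 <= 2 * (L%:R ^+ d / (2 * pi) ^+ 2) :> R.
  by rewrite mulr_ge0// divr_ge0// exprn_ge0// mulr_ge0// ltW.
apply: le_trans (_ : _ <= 2 * (L%:R ^+ d / (2 * pi) ^+ 2) * _) _; last first.
  by rewrite -mulrA.
apply: le_trans (ler_wpM2l c0 h); rewrite le_eqVlt; apply/orP; left; apply/eqP.
have Ld : L%:R ^+ d != 0 :> R by rewrite expf_neq0.
have cancel (x y p f : R) : x != 0 -> y != 0 -> 0 < p ->
    f = 2 * (y / (2 * p) ^+ 2) * (x * (2 * p ^+ 2 * (f / (x * y)))).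
  by move=> x0 y0 p0; field; rewrite x0 y0 gt_eqF.
by rewrite [_ ^+ d.+1]exprS; exact: cancel.
Unshelve. all: by end_near.
Qed.
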